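(* Fix a seed graph $S$ and a Markov sequential attachment rule $\mathcal{G}$. Let $\{G_t\}_{t \geq |S|}$ be a sequence of randomly growing graphs with seed $S$ and attachment rule $\mathcal{G}$. Suppose that there is a function $f : \mathrm{Range}(\mathcal{G}, S) \to \mathbb{R}$ such that the limit $\lim_{t \to \infty} f(G_t) =: f_{\infty}$ exists almost surely and $f_{\infty}$ is an absolutely continuous random variable. Then $$\lim_{t_{\star} \to \infty} \lim_{n \to \infty} \mathrm{TV}\left( \mathcal{CG}(n, t_{\star}, S), \mathcal{G}(n, S)^{\otimes 2} \right) = 1.$$
   Context: Graphs are finite and unlabeled (two isomorphic graphs are regarded as equal); $|G|$ denotes the number of vertices of $G$. A model of randomly growing graphs is given by a seed graph $S$ and a (probabilistic) sequential attachment rule $\mathcal{G}$: the random sequence $\{G_t\}_{t \geq |S|}$ satisfies $G_{|S|} = S$, and given $G_t$, the graph $G_{t+1}$ is formed from $G_t$ by adding a single new vertex that is attached to some of the vertices of $G_t$, chosen at random according to $\mathcal{G}$. The rule is Markov if for every $t \geq |S|$, $\mathbb{P}(G_{t+1} = G \mid G_{|S|}, \ldots, G_t) = \mathbb{P}(G_{t+1} = G \mid G_t)$; thus the growth is described by a transition kernel, which is the same whatever the seed. $\mathcal{G}(n, S)$ denotes the law of $G_n$ started from seed $S$. $\mathrm{Range}(\mathcal{G}, S)$ is the set of graphs $G$ for which there is an $n$ such that $\mathbb{P}(G_n = G) > 0$ when $G_n \sim \mathcal{G}(n,S)$. For an integer $t_{\star} \geq |S|$ and $n\ge t_\star$, $\mathcal{CG}(n,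 t_{\star}, S)$ denotes the law of the pair $(G_n^1, G_n^2)$, where: for $|S| \leq t \leq t_{\star}$, $G_t^1 = G_t^2 =: G_t$ with $\{G_t\}$ grown from seed $S$ according to $\mathcal{G}$; and, conditionally on $G_{t_{\star}}$, the sequences $\{G_t^1\}_{t \geq t_{\star}}$ and $\{G_t^2\}_{t \geq t_{\star}}$ are independent, both started from $G_{t_{\star}}$ and growing according to $\mathcal{G}$. $\mathcal{G}(n,S)^{\otimes 2}$ is the law of two independent samples of $\mathcal{G}(n,S)$. $\mathrm{TV}(P,Q) = \sup_A |P(A) - Q(A)|$ is total variation distance; it is non-increasing in $n$ above, so the inner limit exists. A random variable is absolutely continuous if its law is absolutely continuous with respect to Lebesgue measure. *)

(* Defs.v *)
From HB Require Import structures.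
From mathcomp Require Import all_boot all_order all_algebra generic_quotient.
From mathcomp Require Import all_classical all_reals all_analysis.

Set Implicit Arguments.
Unset Strict Implicit.
Unset Printing Implicit Defensive.

Import Order.TTheory GRing.Theory Num.Theory.
Import numFieldNormedType.Exports.

Local Open Scope classical_set_scope.
Local Open Scope ring_scope.

(** ** Finite simple graphs up to isomorphism *)

Definition is_sgraph n (e : {ffun 'I_n * 'I_n -> bool}) : bool :=
  [forall x, ~~ e (x, x)] && [forall x, forall y, e (x, y) == e (y, x)].

Record sgraph n := SGraph {
  sgraph_adj : {ffun 'I_n * 'I_n -> bool};
  sgraphP : is_sgraph sgraph_adj }.

HB.instance Definition _ n := [isSub for @sgraph_adj n].
HB.instance Definition _ n := [Countable of sgraph n by <:].

(** A labelled graph: a number of vertices [n] and a graph on ['I_n]. *)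
Definition lgraph := {n : nat & sgraph n}.
HB.instance Definition _ := Countable.on lgraph.

Definition lorder (g : lgraph) : nat := tag g.
Definition adj (g : lgraph) (x y : 'I_(lorder g)) : bool :=
  sgraph_adj (tagged g) (x, y).

Lemma adj_irr (g : lgraph) (x : 'I_(lorder g)) : adj x x = false.
Proof.
by have /andP[/forallP/(_ x)/negbTE] := sgraphP (tagged g).
Qed.

Lemma adj_sym (g : lgraph) (x y : 'I_(lorder g)) : adj x y = adj y x.
Proof.
by have /andP[_ /forallP/(_ x)/forallP/(_ y)/eqP] := sgraphP (tagged g).
Qed.

Definition graph_iso (g h : lgraph) : bool :=
  (lorder g == lorder h) &&
  [exists phi : {ffun 'I_(lorder g) -> 'I_(lorder h)},
    injectiveb phi && [forall x, forall y, adj (phi x) (phi y) == adj x y]].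

Lemma graph_isoP (g h : lgraph) :
  reflect (exists2 phi : 'I_(lorder g) -> 'I_(lorder h),
             bijective phi & forall x y, adj (phi x) (phi y) = adj x y)
          (graph_iso g h).
Proof.
apply: (iffP andP) => [[/eqP gh /existsP[phi /andP[/injectiveP phiI /forallP H]]]|].
  exists phi; last by move=> x y; have /forallP/(_ y)/eqP := H x.
  by apply: inj_card_bij => //; rewrite !card_ord gh.
move=> [phi bphi H]; split.
  by have := bij_eq_card bphi; rewrite !card_ord => ->.
apply/existsP; exists (finfun phi); apply/andP; split.
  by apply/injectiveP => x y; rewrite !ffunE; exact: (bij_inj bphi).
by apply/forallP => x; apply/forallP => y; rewrite !ffunE H.
Qed.

Lemma graph_iso_refl : reflexive graph_iso.
Proof. by move=> g; apply/graph_isoP; exists id => //; exists id. Qed.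

Lemma graph_iso_sym : symmetric graph_iso.
Proof.
suff H g h : graph_iso g h -> graph_iso h g.
  by move=> g h; apply/idP/idP; exact: H.
move=> /graph_isoP[phi [psi pK pK'] H]; apply/graph_isoP; exists psi.
  by exists phi.
by move=> x y; rewrite -H !pK'.
Qed.

Lemma graph_iso_trans : transitive graph_iso.
Proof.
move=> h g k /graph_isoP[phi bphi H] /graph_isoP[psi bpsi H']; apply/graph_isoP.
exists (psi \o phi); first exact: bij_comp.
by move=> x y /=; rewrite H' H.
Qed.

Canonical graph_iso_equiv :=
  EquivRel graph_iso graph_iso_refl graph_iso_sym graph_iso_trans.

Local Open Scope quotient_scope.

(** An unlabeled graph is an isomorphism class of labelled graphs. *)
Definition ugraph := {eq_quot graph_iso}.
HB.instance Definition _ := EqQuotient.on ugraph.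
HB.instance Definition _ := Choice.on ugraph.
HB.instance Definition _ := Countable.copy ugraph (can_type (@reprK _ ugraph)).

Lemma is_sgraph0 : is_sgraph [ffun _ : 'I_0 * 'I_0 => false].
Proof. by apply/andP; split; apply/forallP => -[]. Qed.

HB.instance Definition _ := isPointed.Build ugraph
  (\pi_ugraph (Tagged sgraph (SGraph is_sgraph0))).

HB.instance Definition _ := @isMeasurable.Build default_measure_display
  ugraph discrete_measurable discrete_measurable0
  discrete_measurableC discrete_measurableU.

Lemma measurable_ugraph (A : set ugraph) : measurable A.
Proof. by []. Qed.

Definition num_vertices (g : ugraph) : nat := lorder (repr g).

Lemma pi_ugraphP (g h : lgraph) :
  \pi_ugraph g = \pi_ugraph h <-> graph_iso g h.
Proof. by split=> [/eqP|] H; [move: H|apply/eqP]; rewrite eqmodE. Qed.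

Lemma num_vertices_pi (g : lgraph) : num_vertices (\pi_ugraph g) = lorder g.
Proof.
by have /pi_ugraphP/andP[/eqP] := reprK (\pi_ugraph g).
Qed.

(** [add_vertex g A]: the graph [g] with one new vertex, the last element of
    ['I_(lorder g).+1], joined to the vertices in [A] and to no other. *)
Definition add_vertex_adj (g : lgraph) (A : {set 'I_(lorder g)}) :
    {ffun 'I_(lorder g).+1 * 'I_(lorder g).+1 -> bool} :=
  [ffun p => match unlift ord_max p.1, unlift ord_max p.2 with
             | Some i, Some j => adj i j
             | Some i, None | None, Some i => i \in A
             | None, None => false
             end].

Lemma add_vertex_subproof (g : lgraph) (A : {set 'I_(lorder g)}) :
  is_sgraph (add_vertex_adj A).
Proof.
apply/andP; split; apply/forallP => x.
  by rewrite ffunE /=; case: unliftP => //= i _; rewrite adj_irr.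
apply/forallP => y; rewrite !ffunE /=.
by case: (unlift _ x) => [i|]; case: (unlift _ y) => [j|] //=; rewrite adj_sym.
Qed.

Definition add_vertex (g : lgraph) (A : {set 'I_(lorder g)}) : lgraph :=
  Tagged sgraph (SGraph (add_vertex_subproof A)).

Definition extensions (g : ugraph) : set ugraph :=
  [set h | exists (g0 : lgraph) (A : {set 'I_(lorder g0)}),
     g = \pi_ugraph g0 /\ h = \pi_ugraph (add_vertex A)].

(** ** Mixtures of probability measures over random graphs *)

Section mixture.
Context d (T : measurableType d) (R : realType).
Variables (mu : probability ugraph R) (k : ugraph -> probability T R).
Local Open Scope ereal_scope.

Definition mixture (A : set T) : \bar R := \int[mu]_g k g A.

Let mixture0 : mixture set0 = 0.
Proof. by apply: integral0_eq => g _; rewrite measure0. Qed.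

Let mixture_ge0 A : 0 <= mixture A.
Proof. exact: integral_ge0. Qed.

Let mixture_sigma_additive : semi_sigma_additive mixture.
Proof.
move=> U mU tU mUU; rewrite [X in _ --> X](_ : _ =
  \int[mu]_g (\sum_(n <oo) k g (U n))); last first.
  by apply: eq_integral => g _; exact/esym/cvg_lim/measure_semi_sigma_additive.
apply/cvg_closeP; split.
  by apply: is_cvg_nneseries => n _ _; exact: integral_ge0.
by rewrite closeE// integral_nneseries.
Qed.

HB.instance Definition _ := isMeasure.Build _ _ _ mixture
  mixture0 mixture_ge0 mixture_sigma_additive.

Let mixture_setT : mixture setT = 1.
Proof.
rewrite /mixture (eq_integral (cst 1)); last first.
  by move=> g _; exact: (probability_setT (k g)).
by rewrite integral_cst// mul1e; exact: (probability_setT mu).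
Qed.

HB.instance Definition _ := Measure_isProbability.Build _ _ _ mixture
  mixture_setT.

End mixture.

(** ** Randomly growing graphs *)

(** The Markov transition kernel of a sequential attachment rule: from [g], a
    single new vertex is added and joined to a random set of vertices of [g].
    The time is the number of vertices, so the kernel need not depend on it.
    The sigma-algebra on [ugraph] is discrete, so the family is automatically
    measurable. *)
Record attachment_rule (R : realType) := AttachmentRule {
  attach_kernel :> ugraph -> probability ugraph R;
  attach_kernelP : forall g, attach_kernel g (extensions g) = 1%E }.

Section growth.
Context (R : realType).
Variable K : attachment_rule R.

Fixpoint growth_steps (S : ugraph) (m : nat) : probability ugraph R :=
  if m is m'.+1 then mixture (growth_steps S m') K else \d_S.

(** The law of the graph with [n] vertices grown from the seed [S]
    (meaningful for [num_vertices S <= n]). *)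
Definition growth_law (n : nat) (S : ugraph) : probability ugraph R :=
  growth_steps S (n - num_vertices S).

Definition growth_law_pair (n : nat) (S : ugraph) :
    probability (ugraph * ugraph)%type R :=
  (growth_law n S \x growth_law n S)%E.

(** Draw the common graph at time [tstar]; given its value [H], grow two
    conditionally independent copies from the seed [H] up to time [n]
    (meaningful for [num_vertices S <= tstar <= n]). *)
Definition correlated_growth_law (n tstar : nat) (S : ugraph) :
    probability (ugraph * ugraph)%type R :=
  mixture (growth_law tstar S) (growth_law_pair n).

Definition growth_range (S : ugraph) : set ugraph :=
  [set g | exists2 n, (num_vertices S <= n)%N & (0 < growth_law n S [set g])%E].

(** [G] is a Markov chain with kernel [K] started from [S] at time |S|; the
    variables [G t] with [t] < |S| are irrelevant. The second clause is
    P(G_(t+1) = g | G_|S|, ..., G_t) = K(G_t, {g}), multiplied by the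
    probability of the conditioning event. *)
Definition growth_process d (Omega : measurableType d) (P : probability Omega R)
    (S : ugraph) (G : nat -> {RV P >-> ugraph}) : Prop :=
  P [set w | G (num_vertices S) w = S] = 1%E /\
  forall (t : nat) (h : nat -> ugraph) (g : ugraph),
    (num_vertices S <= t)%N ->
    let past :=
      [set w | forall s, (num_vertices S <= s <= t)%N -> G s w = h s] in
    P (past `&` [set w | G t.+1 w = g]) = (P past * K (h t) [set g])%E.

End growth.

Definition TV d (T : measurableType d) (R : realType) (P Q : probability T R)
    : R :=
  sup [set `|fine (P A) - fine (Q A)| | A in measurable].

Definition absolutely_continuous d (Omega : measurableType d) (R : realType)
    (P : probability Omega R) (X : {RV P >-> R}) : Prop :=
  distribution P X `<< (@lebesgue_measure R).

(* Main.v *)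
Require Import Defs.
From mathcomp Require Import all_boot all_order all_algebra.
From mathcomp Require Import all_classical all_reals all_analysis.
From mathcomp Require Import measurable_realfun lra.

(** Why the theorem is true.

    Write [F] for [f] extended by 0 and [X] for the limit of [F (G t)].
    A single test event separates the two laws: the set [close_pairs F c] of
    pairs [(g, g')] with [|F g - F g'| < c].

    - Under the correlated law both copies are grown from the same graph [H]
      with [tstar] vertices. As [F (G t)] converges almost surely, it is Cauchy
      in probability, so for [tstar] large both values of [F] have hardly moved
      away from [F H] at any later time, and the pair is close with probability
      near 1 ([correlated_far_le]).
    - Under the product law, fix the first copy [g]; the pair is close when the
      second value of [F] falls in the interval of radius [c] around [F g]. Up
      to a small error this value is [X], and the law of [X] gives small mass to
      every short interval, uniformly in the centre, because it is absolutely
      continuous ([product_close_le], [pushforward_epsilon_delta]).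

    Hence the total variation distance is at least [1 - e] for all
    [n >= tstar] as soon as [tstar] is large ([TV_correlated_near1]).

    The probabilities above are computed on the space carrying the process, so
    one needs the joint law of [(G t, G n)] in terms of the kernel
    ([growth_process_pair_law]). The Markov property is given for complete
    histories only; [past_step] sums it over the one new vertex of the history,
    and iterating this removes the history.

    The inner limit exists because the distance is nonincreasing in [n]: one
    growth step applies the same kernel, two independent attachments, to both
    laws ([correlated_growth_lawS], [growth_law_pairS]), and a kernel cannot
    increase the total variation distance ([TV_data_processing]). *)

Import Order.TTheory GRing.Theory Num.Theory.
Import numFieldNormedType.Exports.

Set Implicit Arguments.
Unset Strict Implicit.
Unset Printing Implicit Defensive.

Local Open Scope classical_set_scope.
Local Open Scope ring_scope.

(** * Total variation distance *)

Section total_variation.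
Context d (T : measurableType d) (R : realType).
Implicit Types P Q : probability T R.

Lemma probability_fin_num P A : measurable A -> P A \is a fin_num.
Proof. by move=> mA; rewrite fin_num_measure. Qed.

Lemma TV_terms_ubound P Q :
  ubound [set `|fine (P A) - fine (Q A)| | A in measurable] 1.
Proof.
move=> _ [A mA <-].
have b (m : probability T R) : 0 <= fine (m A) <= 1.
  rewrite fine_ge0//= -lee_fin fineK ?probability_fin_num//.
  exact: probability_le1.
by have /andP[? ?] := b P; have /andP[? ?] := b Q; rewrite ler_norml; lra.
Qed.

Lemma TV_ge P Q A : measurable A -> `|fine (P A) - fine (Q A)| <= TV P Q.
Proof.
move=> mA; apply: ub_le_sup; last by exists A.
by exists 1; exact: TV_terms_ubound.
Qed.

Lemma TV_le P Q r :
  (forall A, measurable A -> `|fine (P A) - fine (Q A)| <= r) -> TV P Q <= r.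
Proof.
move=> Pr; apply: ge_sup.
  by exists `|fine (P set0) - fine (Q set0)|, set0.
by move=> _ [A mA <-]; exact: Pr.
Qed.

Lemma TV_le1 P Q : TV P Q <= 1.
Proof. by apply: TV_le => A mA; apply: TV_terms_ubound; exists A. Qed.

Lemma TV_ge0 P Q : 0 <= TV P Q.
Proof. exact: le_trans (TV_ge P Q measurable0). Qed.

Lemma TV_sym P Q : TV P Q = TV Q P.
Proof. by congr sup; apply: eq_imagel => A mA; rewrite distrC. Qed.

Lemma TV_measure_le P Q A : measurable A -> (P A <= Q A + (TV P Q)%:E)%E.
Proof.
move=> mA; have := le_trans (ler_norm _) (TV_ge P Q mA).
by rewrite lerBlDl -lee_fin EFinD !fineK// probability_fin_num.
Qed.

Local Open Scope ereal_scope.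

(** The supremum over events already controls all test functions with values in
    [[0, 1]]: the positive part of [P - Q] in its Jordan decomposition is a
    measure [pos] with [P <= Q + pos] whose total mass is the excess of [P] over
    [Q] on a single event, the positive Hahn set. *)
Lemma TV_integral_le P Q (h : T -> \bar R) :
  measurable_fun setT h -> (forall x, 0 <= h x <= 1) ->
  \int[P]_x h x <= \int[Q]_x h x + (TV P Q)%:E.
Proof.
move=> mh h01; have h0 x : 0 <= h x by case/andP: (h01 x).
pose nu : {charge set T -> \bar R} := cadd (charge_of_finite_measure P)
  (cscale (-1) (charge_of_finite_measure Q)).
have nuE A : nu A = P A - Q A by rewrite /nu /= /cadd /= cscaleN1.
have [A [N hAN]] := Hahn_decomposition nu.
have mA : measurable A by case: hAN => -[].
pose pos := jordan_pos hAN.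
have posE B : measurable B -> pos B = P (B `&` A) - Q (B `&` A).
  by move=> mB; rewrite -nuE /pos jordan_posE cjordan_posE /crestr0 mem_set.
have PQ B : measurable B -> P B <= measure_add Q pos B.
  move=> mB; rewrite measure_addE -leeBlDl ?probability_fin_num// -nuE.
  rewrite (jordan_decomp hAN mB) /cadd /= cscaleN1.
  by rewrite -[leRHS]adde0; apply: leeD => //; rewrite oppe_le0.
apply: (@le_trans _ _ (\int[measure_add Q pos]_x h x)).
  exact: ge0_le_measure_integral.
rewrite ge0_integral_measure_add//; apply: leeD => //.
apply: (@le_trans _ _ (\int[pos]_x 1)).
  by apply: ge0_le_integral => // x _; case/andP: (h01 x).
rewrite integral_cst// mul1e [leLHS](posE setT measurableT) setTI.
rewrite leeBlDl ?probability_fin_num//; exact: TV_measure_le.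
Qed.

End total_variation.

Section data_processing.
Context d d' (X : measurableType d) (Y : measurableType d') (R : realType).

(** As a function of [x], [k x A] is a test function with values in [[0, 1]]. *)
Lemma TV_data_processing (P Q : probability X R) (P' Q' : probability Y R)
    (k : X -> probability Y R) :
  (forall A, measurable A -> measurable_fun setT (fun x => k x A)) ->
  (forall A, measurable A -> P' A = \int[P]_x k x A)%E ->
  (forall A, measurable A -> Q' A = \int[Q]_x k x A)%E ->
  TV P' Q' <= TV P Q.
Proof.
move=> mk P'E Q'E; apply: TV_le => A mA.
have k01 x : (0 <= k x A <= 1)%E by rewrite measure_ge0 probability_le1.
have PQ := TV_integral_le P Q (mk A mA) k01.
have QP := TV_integral_le Q P (mk A mA) k01.
rewrite TV_sym -P'E// -Q'E// in QP; rewrite -P'E// -Q'E// in PQ.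
move: PQ QP; rewrite -(fineK (probability_fin_num P' mA)).
rewrite -(fineK (probability_fin_num Q' mA)) -!EFinD !lee_fin /= => PQ QP.
by rewrite ler_norml; lra.
Qed.

End data_processing.

(** * Uniform smallness from absolute continuity *)

Section absolute_continuity.
Context d d' (Omega : measurableType d) (T : measurableType d') (R : realType).
Local Open Scope ereal_scope.

(** If the conclusion failed, there would be sets [F n] with summable
    [mu]-measures and [P (X @^-1` F n) >= e]; by Borel-Cantelli their limit
    superior is [mu]-negligible, yet [X] meets it with probability at least [e].
    The law of [X] is written as a push-forward so that [T] may carry any
    sigma-algebra for which [X] is measurable, such as the one on which the
    Lebesgue measure is built. *)
Lemma pushforward_epsilon_delta (P : {finite_measure set Omega -> \bar R})
    (X : Omega -> T) (mu : {measure set T -> \bar R}) (e : R) :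
  measurable_fun setT X -> pushforward P X `<< mu -> (0 < e)%R ->
  exists2 r : R, (0 < r)%R &
    forall A, measurable A -> mu A <= r%:E -> P (X @^-1` A) < e%:E.
Proof.
move=> mX Xmu e0; apply: contrapT => noR.
have {}noR (n : nat) : exists A, [/\ measurable A,
    mu A <= (1 / (2 ^ (n + 1))%:R)%:E & e%:E <= P (X @^-1` A)].
  apply: contrapT => noA; apply: noR; exists (1 / (2 ^ (n + 1))%:R)%R.
    by rewrite divr_gt0// ltr0n expn_gt0.
  move=> A mA muA; rewrite ltNge; apply/negP => PA.
  by apply: noA; exists A; split.
have [F F_spec] := choice noR.
have mF n : measurable (F n) by have [] := F_spec n.
have mXF n : measurable (X @^-1` F n).
  by rewrite -[Y in measurable Y]setTI; exact: mX.
have mlim : measurable (lim_sup_set F).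
  by apply: bigcap_measurable => // k _; exact: bigcup_measurable.
have mu0 : mu (lim_sup_set F) = 0.
  apply: lim_sup_set_cvg0 => //.
  apply: (@le_lt_trans _ _ (\sum_(n <oo) (1 / (2 ^ (n + 1))%:R)%:E)).
    by apply: lee_nneseries => // n _; have [] := F_spec n.
  by rewrite (cvg_lim _ (@cvg_geometric_eseries_half R 1 0))// ltry.
have P0 : P (lim_sup_set (fun n => X @^-1` F n)) = 0.
  by move/null_content_dominatesP : Xmu => /(_ _ mlim mu0).
have Poo : P (\bigcup_(k >= 0) X @^-1` F k) < +oo.
  by rewrite ltey_eq fin_num_measure//; exact: bigcup_measurable.
have P_cvg := lim_sup_set_cvg P _ mXF Poo.
have : e%:E <= P (lim_sup_set (fun n => X @^-1` F n)).
  rewrite -(cvg_lim _ P_cvg)//.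
  apply: lime_ge; first by apply: cvgP P_cvg.
  apply: nearW => n; have [_ _ /le_trans] := F_spec n; apply.
  rewrite le_measure ?inE//; first exact: bigcup_measurable.
  by move=> w Fw; exists n => /=.
by rewrite P0 lee_fin leNgt e0.
Qed.

End absolute_continuity.

(** * Mixtures of laws on graphs *)

Section mixtures.
Context (R : realType).
Local Open Scope ereal_scope.

(** There are countably many graphs, so the product sigma-algebra is discrete
    as well. *)
Lemma measurable_ugraph_pair (A : set (ugraph * ugraph)) : measurable A.
Proof.
rewrite (_ : A = \bigcup_g ([set g] `*` xsection A g)); last first.
  apply/seteqP; split=> [[g h] Agh|[g h] [g0 _ [/= -> /xsectionP]]//].
  by exists g => //; split=> //; apply/xsectionP.
apply: countable_bigcupT_measurable => // g; exact: measurableX.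
Qed.

(** A mixture is the composition of a constant kernel with [k], so this is the
    integration formula for composed kernels. *)
Lemma integral_mixture d (T : measurableType d) (mu : probability ugraph R)
    (k : ugraph -> probability T R) (h : T -> \bar R) :
  measurable_fun setT h -> (forall x, 0 <= h x) ->
  \int[mixture mu k]_x h x = \int[mu]_g \int[k g]_x h x.
Proof.
move=> mh h0.
pose l : unit -> pprobability ugraph R := fun=> mu.
have ml : measurable_fun setT l by exact: measurable_cst.
pose k' : unit * ugraph -> pprobability T R := k \o snd.
have mk' : measurable_fun setT k'.
  have mk : measurable_fun setT (k : ugraph -> pprobability T R) by [].
  exact: measurableT_comp mk measurable_snd.
have := @integral_kcomp _ _ _ _ _ _ R (kprobability ml) (kprobability mk') tt h
  h0 mh.
by move=> <-; exact: eq_measure_integral.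
Qed.

(** Two independent draws from mixtures amount to drawing the pair of parameters
    from the product and then two conditionally independent samples. *)
Lemma mixture_pair (mu nu : probability ugraph R)
    (k : ugraph -> probability ugraph R) (A : set (ugraph * ugraph)) :
  (mixture mu k \x mixture nu k) A =
  \int[mu \x nu]_x (k x.1 \x k x.2) A.
Proof.
have mf d' (T' : measurableType d') (f : ugraph * ugraph -> T') :
  measurable_fun setT f by move=> _ B _; exact: measurable_ugraph_pair.
rewrite [LHS]integral_mixture//.
pose f (x : ugraph * ugraph) := (k x.1 \x k x.2) A.
have f0 x : 0 <= f x by exact: integral_ge0.
rewrite [RHS](@fubini_tonelli1 _ _ _ _ _ mu nu f (mf _ _ f) f0).
apply: eq_integral => g _; rewrite /fubini_F /=.
pose F (z : ugraph * ugraph) := k z.2 (xsection A z.1).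
have F0 z : 0 <= F z by exact: measure_ge0.
exact: (@fubini_tonelli _ _ _ _ _ (k g) nu F (mf _ _ F) F0).
Qed.

End mixtures.

(** * The distance is nonincreasing in time *)

Section growth.
Context (R : realType) (K : attachment_rule R).
Implicit Types (S g h : ugraph) (m n t : nat).
Local Open Scope ereal_scope.

Lemma num_vertices_extensions g h : extensions g h ->
  num_vertices h = (num_vertices g).+1.
Proof. by move=> [g0 [A [-> ->]]]; rewrite !num_vertices_pi. Qed.

(** After [m] steps the graph almost surely has [m] more vertices than the seed,
    so an integrand only matters on graphs of that size. This is what allows
    [growth_law], whose number of steps depends on the size of its seed, to be
    handled under an integral over random seeds. *)
Lemma eq_integral_growth S m (u v : ugraph -> \bar R) :
  (forall g, 0 <= u g) -> (forall g, 0 <= v g) ->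
  (forall g, num_vertices g = (num_vertices S + m)%N -> u g = v g) ->
  \int[growth_steps K S m]_g u g = \int[growth_steps K S m]_g v g.
Proof.
elim: m u v => [|m IH] u v u0 v0 uv /=.
  by rewrite !integral_dirac// uv// addn0.
rewrite !integral_mixture//; apply: IH => g.
- exact: integral_ge0.
- exact: integral_ge0.
move=> gm; apply: ge0_ae_eq_integral => //.
exists (~` extensions g); split=> //.
  by rewrite [LHS](probability_setC (K g))// attach_kernelP subee.
move=> h /= uvh /num_vertices_extensions; rewrite gm -addnS => /uv uvE.
exact: uvh.
Qed.

Lemma growth_lawS n S : (num_vertices S <= n)%N ->
  growth_law K n.+1 S = mixture (growth_law K n S) K.
Proof. by move=> Sn; rewrite /growth_law subSn. Qed.

Lemma growth_law_pairS n S A : (num_vertices S <= n)%N ->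
  growth_law_pair K n.+1 S A =
  \int[growth_law_pair K n S]_x (K x.1 \x K x.2) A.
Proof.
by move=> Sn; rewrite /growth_law_pair growth_lawS//; exact: mixture_pair.
Qed.

Lemma correlated_growth_lawS n t S A : (num_vertices S <= t <= n)%N ->
  correlated_growth_law K n.+1 t S A =
  \int[correlated_growth_law K n t S]_x (K x.1 \x K x.2) A.
Proof.
move=> /andP[St tn]; rewrite [RHS]integral_mixture; last 2 first.
- by move=> _ B _; exact: measurable_ugraph_pair.
- by move=> x; exact: integral_ge0.
apply: eq_integral_growth => [g|g|g]; [exact: integral_ge0|..].
  by apply: integral_ge0 => x _; exact: integral_ge0.
by rewrite subnKC// => gt; apply: growth_law_pairS; rewrite gt.
Qed.

(** Both laws at time [n.+1] arise from those at time [n] through the kernel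
    that attaches a vertex to each coordinate independently. *)
Lemma TV_correlated_nonincreasing n t S : (num_vertices S <= t <= n)%N ->
  (TV (correlated_growth_law K n.+1 t S) (growth_law_pair K n.+1 S) <=
   TV (correlated_growth_law K n t S) (growth_law_pair K n S))%R.
Proof.
move=> Stn; apply: (@TV_data_processing _ _ _ _ R _ _ _ _
  (fun x => (K x.1 \x K x.2)%E : probability _ R)).
- by move=> A _ _ B _; exact: measurable_ugraph_pair.
- by move=> A _; exact: correlated_growth_lawS.
- move=> A _; apply: growth_law_pairS.
  by case/andP: Stn => /leq_trans; apply.
Qed.

Lemma TV_correlated_cvg t S : (num_vertices S <= t)%N ->
  cvgn (fun n => TV (correlated_growth_law K n t S) (growth_law_pair K n S)).
Proof.
move=> St; set u := (fun n : nat => _).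
have /cvg_ex[l] : cvgn [sequence u (n + t)%N]_n.
  apply: nonincreasing_is_cvgn.
    apply/nonincreasing_seqP => n /=.
    rewrite /u addSn; apply: TV_correlated_nonincreasing.
    by rewrite St leq_addl.
  by exists 0%R => _ [n _ <-]; exact: TV_ge0.
by rewrite cvg_shiftn => ul; apply/cvg_ex; exists l.
Qed.

End growth.

(** * The joint law of the process at two times *)

Section growth_process.
Context (R : realType) (K : attachment_rule R).
Context d (Omega : measurableType d) (P : probability Omega R).
Context (S : ugraph) (G : nat -> {RV P >-> ugraph}).
Hypothesis G_growth : growth_process K S G.
Local Open Scope ereal_scope.

(** The fibers of an injective numbering of graphs: a partition indexed by [nat]
    into singletons and empty sets, in the form required by countable
    additivity. *)
Let code_fiber (i : nat) : set ugraph := [set g | pickle g = i].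

Let bigcup_code_fiber : \bigcup_i code_fiber i = setT.
Proof. by apply/seteqP; split=> // g _; exists (pickle g). Qed.

Let trivIset_code_fiber : trivIset setT code_fiber.
Proof. by move=> i j _ _ [g [<- <-]]. Qed.

Let code_fiberP i : code_fiber i = set0 \/ exists g, code_fiber i = [set g].
Proof.
have [[g gi]|nog] := pselect (exists g, code_fiber i g); last first.
  by left; apply/seteqP; split=> // g gi; apply: nog; exists g.
right; exists g; apply/seteqP; split=> [g' /= g'i|_ /= ->//].
by apply: (pcan_inj pickleK); rewrite g'i gi.
Qed.

(** The Chapman-Kolmogorov equation: [growth_steps] is defined by its last step,
    whereas conditioning on the past removes the first one. *)
Lemma integral_growth_steps_first g m (v : ugraph -> \bar R) :
  (forall x, 0 <= v x) ->
  \int[growth_steps K g m.+1]_x v x =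
  \int[K g]_g' \int[growth_steps K g' m]_x v x.
Proof.
elim: m v => [|m IH] v v0.
  rewrite [LHS]integral_mixture// integral_dirac// diracT mul1e.
  by apply: eq_integral => g' _; rewrite integral_dirac// diracT mul1e.
rewrite [LHS]integral_mixture// IH; last by move=> x; exact: integral_ge0.
by apply: eq_integral => g' _; rewrite [RHS]integral_mixture.
Qed.

Definition past t (h : nat -> ugraph) : set Omega :=
  [set w | forall s, (num_vertices S <= s <= t)%N -> G s w = h s].

Lemma measurable_RV_preimage t (A : set ugraph) : measurable (G t @^-1` A).
Proof. by rewrite -[X in measurable X]setTI; exact: measurable_funPT. Qed.

Lemma measurable_past t h : measurable (past t h).
Proof.
rewrite (_ : past t h = \bigcap_(s in [set s | num_vertices S <= s <= t]%N)
    G s @^-1` [set h s]).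
  by apply: bigcap_measurableType => s _; exact: measurable_RV_preimage.
by apply/seteqP; split=> w.
Qed.

(** If, given any history up to time [t.+1], the conditional probability of [E]
    is a function [v] of the last graph, then given a history up to time [t] it
    is the mean of [v] under one growth step: split according to the graph at
    time [t.+1], each value of which extends the history, and apply the Markov
    property to every piece. *)
Lemma past_step (E : set Omega) (v : ugraph -> \bar R) t h :
  measurable E -> (forall g, 0 <= v g) -> (num_vertices S <= t)%N ->
  (forall h, P (past t.+1 h `&` E) = P (past t.+1 h) * v (h t.+1)) ->
  P (past t h `&` E) = P (past t h) * \int[K (h t)]_g v g.
Proof.
move=> mE v0 St vE.
have mpE : measurable (past t h `&` E).
  by apply: measurableI => //; exact: measurable_past.
pose C i := past t h `&` E `&` G t.+1 @^-1` code_fiber i.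
have -> : past t h `&` E = \bigcup_i C i.
  rewrite -setI_bigcupr -preimage_bigcup bigcup_code_fiber preimage_setT.
  by rewrite setIT.
have mC i : measurable (C i).
  by apply: measurableI => //; exact: measurable_RV_preimage.
rewrite measure_semi_bigcup//; last 2 first.
- by move=> i j _ _ [w [[_ wi] [_ wj]]]; rewrite -wi -wj.
- exact: bigcup_measurable.
rewrite -bigcup_code_fiber ge0_integral_bigcup//.
have /fineK PpE : P (past t h) \is a fin_num.
  by apply: probability_fin_num; exact: measurable_past.
rewrite -PpE -nneseriesZl; last by move=> i _; exact: integral_ge0.
rewrite PpE.
apply: eq_eseriesr => i _.
rewrite /C; have [->|[g ->]] := code_fiberP i.
  by rewrite preimage_set0 setI0 measure0 integral_set0 mule0.
have -> : \int[K (h t)]_(x in [set g]) v x = v g * K (h t) [set g].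
  rewrite -integral_cst//; apply: eq_integral => x.
  by rewrite inE => ->.
(* The history [h] prolonged by the graph [g] at time [t.+1]. *)
pose h' s := if s == t.+1 then g else h s.
have pastE : past t.+1 h' = past t h `&` G t.+1 @^-1` [set g].
  apply/seteqP; split=> [w pw|w [pw Gw] s /andP[Ss st]].
    split=> [s /andP[Ss st]|/=]; last first.
      by rewrite pw ?leqnn ?(leqW St)// /h' eqxx.
    by rewrite pw ?Ss ?(leqW st)// /h' ltn_eqF.
  rewrite /h'; have [->//|st'] := eqVneq s t.+1.
  by apply: pw; rewrite Ss -ltnS ltn_neqAle st' st.
rewrite setIAC -pastE.
rewrite [LHS]vE (_ : h' t.+1 = g) ?pastE; last by rewrite /h' eqxx.
have -> : P (past t h `&` G t.+1 @^-1` [set g]) =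
    P (past t h) * K (h t) [set g].
  by case: G_growth => _; exact.
by rewrite -muleA (muleC (v g)).
Qed.

Lemma past_growth (E : set Omega) (v : ugraph -> \bar R) s t h :
  measurable E -> (forall g, 0 <= v g) -> (num_vertices S <= s <= t)%N ->
  (forall h, P (past t h `&` E) = P (past t h) * v (h t)) ->
  P (past s h `&` E) =
  P (past s h) * \int[growth_steps K (h s) (t - s)]_g v g.
Proof.
move=> mE v0 /andP[Ss st] vE; rewrite -(subnKC st) in vE.
move: (t - s)%N => m in vE *; elim: m s Ss vE h {st} => [|m IH] s Ss vE h.
  by rewrite integral_dirac// diracT mul1e; rewrite addn0 in vE.
rewrite integral_growth_steps_first//; apply: past_step => // [g|h'].
  exact: integral_ge0.
by apply: IH; rewrite ?(leqW Ss)// addSnnS.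
Qed.

Lemma past_seed : P (past (num_vertices S) (fun=> S)) = 1.
Proof.
case: G_growth => <- _; congr (P _); apply/seteqP; split=> w.
  by move=> /(_ (num_vertices S)); rewrite leqnn; exact.
by move=> Gw s /anti_leq <-.
Qed.

(** The history at time [num_vertices S] is reduced to the seed and is almost
    sure, so here the conditioning disappears. *)
Lemma process_growth (E : set Omega) (v : ugraph -> \bar R) t :
  measurable E -> (forall g, 0 <= v g) -> (num_vertices S <= t)%N ->
  (forall h, P (past t h `&` E) = P (past t h) * v (h t)) ->
  P E = \int[growth_law K t S]_g v g.
Proof.
move=> mE v0 St vE; rewrite /growth_law.
have := @past_growth E v (num_vertices S) t (fun=> S) mE v0.
rewrite leqnn St past_seed => /(_ isT vE).
rewrite mul1e => <-.
have mp : measurable (past (num_vertices S) (fun=> S)).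
  exact: measurable_past.
rewrite -[in LHS](setIT E) -(setUv (past (num_vertices S) (fun=> S))) setIUr.
rewrite setIC measureU0 //; [exact: measurableI| |].
  by apply: measurableI => //; exact: measurableC.
apply: (@subset_measure0 _ _ _ _ _ (~` past (num_vertices S) (fun=> S))) => //.
- by apply: measurableI => //; exact: measurableC.
- exact: measurableC.
by rewrite [LHS](probability_setC P)// past_seed subee.
Qed.

(** At time [n] itself the event depends on the last graph through an indicator
    function; descend from there to time [t]. *)
Lemma past_growth_at t n h (B : set ugraph) : (num_vertices S <= t <= n)%N ->
  P (past t h `&` G n @^-1` B) =
  P (past t h) * growth_steps K (h t) (n - t) B.
Proof.
move=> /andP[St tn].
rewrite (past_growth (t := n) (v := fun g => (\1_B g)%:E))//.
- by rewrite integral_indic// setIT.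
- exact: measurable_RV_preimage.
- by rewrite St.
move=> h'; have Gn w : past n h' w -> G n w = h' n.
  by apply; rewrite leqnn (leq_trans St).
rewrite indicE; have [hB|hB] := boolP (h' n \in B).
  rewrite mule1; congr (P _); apply/seteqP; split=> [w []//|w pw].
  by split=> //=; rewrite (Gn w pw); exact: set_mem.
rewrite mule0 [X in P X](_ : _ = set0) ?measure0//.
apply/seteqP; split=> // w [pw /= Bw]; move/negP: hB; apply.
by rewrite -(Gn w pw); exact: mem_set.
Qed.

Lemma growth_process_law n (B : set ugraph) : (num_vertices S <= n)%N ->
  P (G n @^-1` B) = growth_law K n S B.
Proof.
move=> Sn; rewrite (process_growth (t := n) (v := fun g => (\1_B g)%:E))//.
- by rewrite integral_indic// setIT.
- exact: measurable_RV_preimage.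
by move=> h; rewrite past_growth_at ?leqnn ?Sn// subnn.
Qed.

(** Given the history up to time [t] the first coordinate is frozen, which
    leaves an event at time [n] alone; its probability is then averaged over
    the graph at time [t]. *)
Lemma growth_process_pair_law t n (D : set (ugraph * ugraph)) :
  (num_vertices S <= t <= n)%N ->
  P [set w | D (G t w, G n w)] =
  \int[growth_law K t S]_H growth_law K n H (xsection D H).
Proof.
move=> /andP[St tn].
have mE : measurable [set w | D (G t w, G n w)].
  have mG : measurable_fun setT (fun w => (G t w, G n w)).
    exact: measurable_fun_pair.
  rewrite -[X in measurable X]setTI.
  by apply: mG => //; exact: measurable_ugraph_pair.
rewrite (process_growth (t := t)
  (v := fun H => growth_steps K H (n - t) (xsection D H)))//; last first.
  move=> h; rewrite -past_growth_at ?St//; congr (P _).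
  have Gt w : past t h w -> G t w = h t by apply; rewrite leqnn St.
  apply/seteqP; split=> w [pw /= wD]; split=> //=.
    by apply/xsectionP; rewrite -(Gt w pw).
  by rewrite (Gt w pw); exact/xsectionP.
apply: eq_integral_growth => // H; rewrite subnKC// => Ht.
by rewrite /growth_law Ht.
Qed.

End growth_process.

(** * Convergence in probability *)

Section convergence_in_probability.
Context (R : realType) d (Omega : measurableType d) (P : probability Omega R).
Local Open Scope ereal_scope.

Lemma measurable_dist_ge (Y Z : Omega -> R) (e : R) :
  measurable_fun setT Y -> measurable_fun setT Z ->
  measurable [set w | (e <= `|Y w - Z w|)%R].
Proof.
move=> mY mZ; rewrite -[X in measurable X]setTI.
have -> : [set w | (e <= `|Y w - Z w|)%R] =
    (fun w => `|Y w - Z w|)%R @^-1` `[e, +oo[%classic.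
  by apply/seteqP; split=> w /=; rewrite in_itv /= andbT.
have : measurable_fun setT (fun w => `|Y w - Z w|)%R.
  by apply: measurableT_comp => //; exact: measurable_funB.
by apply.
Qed.

(** Almost surely [w] lies in only finitely many of the sets where [Y n] is
    [e]-far from [X], so their limit superior is negligible, and the
    probabilities of the tail unions decrease to that of the limit superior. *)
Lemma ae_cvg_in_probability (Y : nat -> Omega -> R) (X : Omega -> R)
    (e eta : R) :
  (forall n, measurable_fun setT (Y n)) -> measurable_fun setT X ->
  {ae P, forall w, Y n w @[n --> \oo] --> X w} -> (0 < e)%R -> (0 < eta)%R ->
  \forall n \near \oo, P [set w | (e <= `|Y n w - X w|)%R] <= eta%:E.
Proof.
move=> mY mX [N [mN N0 Ncvg]] e0 eta0.
pose F n := [set w | (e <= `|Y n w - X w|)%R].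
have mF n : measurable (F n) by exact: measurable_dist_ge.
have mlim : measurable (lim_sup_set F).
  by apply: bigcap_measurable => // k _; exact: bigcup_measurable.
have lim0 : P (lim_sup_set F) = 0.
  apply: subset_measure0 N0 => // w Fw; apply: Ncvg => /= /cvgrPdist_lt.
  move=> /(_ _ e0)[k _ kY]; have [j /= kj] := Fw k I.
  by rewrite /F /= distrC leNgt kY.
have Foo : P (\bigcup_(k >= 0) F k) < +oo.
  by rewrite ltey_eq fin_num_measure//; exact: bigcup_measurable.
have F_cvg : P (\bigcup_(k >= n) F k) @[n --> \oo] --> 0.
  by rewrite -[X in _ --> X]lim0; exact: lim_sup_set_cvg.
have : \forall n \near \oo, P (\bigcup_(k >= n) F k) < eta%:E.
  apply: (F_cvg [set x | x < eta%:E]); apply: open_nbhs_nbhs; split => /=.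
    exact: open_ereal_lt_ereal.
  by rewrite lte_fin.
apply: filterS => n /ltW; apply: le_trans; rewrite le_measure ?inE//.
- exact: mF.
- exact: bigcup_measurable.
by move=> w Fw; exists n => /=.
Qed.

End convergence_in_probability.

(** * The separating event *)

Section close_pairs.
Context (R : realType) (F : ugraph -> R).
Local Open Scope ereal_scope.

Definition close_pairs (e : R) : set (ugraph * ugraph) :=
  [set x | (`|F x.1 - F x.2| < e)%R].

Definition far_pairs (e : R) : set (ugraph * ugraph) :=
  [set x | (e <= `|F x.1 - F x.2|)%R].

(** Two values of [F] that are [e]-far from each other cannot both be within
    [e / 2] of the reference value [F H]. *)
Lemma product_far_pairs (mu : probability ugraph R) (e : R) H :
  (mu \x mu) (~` close_pairs e) <=
  mu (xsection (far_pairs (e / 2)) H) + mu (xsection (far_pairs (e / 2)) H).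
Proof.
set B := xsection _ _.
have -> : mu B + mu B = (mu \x mu) (B `*` setT) + (mu \x mu) (setT `*` B).
  rewrite !product_measure1E// [X in _ * X + _](probability_setT mu).
  by rewrite [X in _ + X * _](probability_setT mu) mule1 mul1e.
have sub : ~` close_pairs e `<=` (B `*` setT) `|` (setT `*` B).
  move=> [g g'] /= /negP; rewrite -leNgt => far.
  have [|gH] := leP (e / 2)%R `|F H - F g|%R.
    by left; split=> //; apply/xsectionP.
  right; split=> //; apply/xsectionP; rewrite /far_pairs /= leNgt.
  apply/negP => g'H; move: far; rewrite leNgt => /negP; apply.
  rewrite (_ : F g - F g' = (F H - F g') - (F H - F g))%R; last by lra.
  by rewrite (le_lt_trans (ler_normB _ _))//; lra.
have mB := @measurable_ugraph_pair.
apply: le_trans (measureU2 (mu \x mu) (mB _) (mB _)).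
by apply: le_measure; rewrite ?inE//; exact: mB.
Qed.

End close_pairs.

Section separating_event.
Context (R : realType) (K : attachment_rule R) d (Omega : measurableType d).
Context (P : probability Omega R) (S : ugraph) (G : nat -> {RV P >-> ugraph}).
Hypothesis G_growth : growth_process K S G.
Context (F : ugraph -> R).
Local Open Scope ereal_scope.

Let mF n : measurable_fun setT (fun w => F (G n w)).
Proof.
have mF0 : measurable_fun setT F by [].
exact: measurableT_comp mF0 _.
Qed.

(** Compare both copies with the common graph [H] at time [t]: each of the pairs
    (common graph, copy) has the law of the process at times [t] and [n]. *)
Lemma correlated_far_le t n (e : R) : (num_vertices S <= t <= n)%N ->
  correlated_growth_law K n t S (~` close_pairs F e) <=
  P [set w | (e / 2 <= `|F (G t w) - F (G n w)|)%R] +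
  P [set w | (e / 2 <= `|F (G t w) - F (G n w)|)%R].
Proof.
move=> Stn.
have -> := growth_process_pair_law G_growth (far_pairs F (e / 2)) Stn.
rewrite -ge0_integralD//; apply: ge0_le_integral => //.
by move=> H _; exact: product_far_pairs.
Qed.

(** By independence, closeness of the second copy to the first one can be
    bounded with the first one fixed, that is, by the concentration of [F (G
    n)] around an arbitrary centre. *)
Lemma product_close_le n (e delta : R) : (num_vertices S <= n)%N ->
  (forall g, P [set w | (`|F (G n w) - F g| < e)%R] <= delta%:E) ->
  growth_law_pair K n S (close_pairs F e) <= delta%:E.
Proof.
move=> Sn concentration.
apply: (@le_trans _ _ (\int[growth_law K n S]_g cst delta%:E g)).
  apply: ge0_le_integral => // g _.
  rewrite /= -(growth_process_law G_growth)//.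
  apply: le_trans (concentration g); rewrite le_eqVlt; apply/orP; left.
  apply/eqP; congr (P _); apply/seteqP.
  by split=> w /=; [move=> /xsectionP|move=> ?; apply/xsectionP];
    rewrite /close_pairs /= distrC.
by rewrite integral_cst// [X in _ * X](probability_setT _) mule1.
Qed.

End separating_event.

(** * The distance is close to 1 *)

Section limit.
Context (R : realType) (K : attachment_rule R) d (Omega : measurableType d).
Context (P : probability Omega R) (S : ugraph) (G : nat -> {RV P >-> ugraph}).
Hypothesis G_growth : growth_process K S G.
Context (F : ugraph -> R) (X : {RV P >-> R}).
Hypothesis F_cvg : {ae P, forall w, F (G t w) @[t --> \oo] --> X w}.
Hypothesis X_ac : absolutely_continuous X.

(** The error [e] is shared by six events of probability at most [e / 6]: each
    copy may be far from the common graph (two events each, through [X] at the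
    two times), and under the product law [F (G n)] may be far from [X], or [X]
    in a short interval. *)
Lemma TV_correlated_near1 (e : R) : 0 < e ->
  \forall t \near \oo, forall n, (t <= n)%N ->
    1 - e <= TV (correlated_growth_law K n t S) (growth_law_pair K n S).
Proof.
move=> e0; have eta0 : 0 < e / 6 by lra.
have mX : measurable_fun setT X by [].
have [r r0 X_small] := @pushforward_epsilon_delta _ _ _ (measurableTypeR R) R
  P X lebesgue_measure _ mX X_ac eta0.
(* The ball of radius [2 * c] has length exactly [r]. *)
pose c := r / 4; have c0 : 0 < c by rewrite /c; lra.
have c40 : 0 < c / 4 by lra.
have mFG n : measurable_fun setT (fun w => F (G n w)).
  by have mF : measurable_fun setT F by []; exact: measurableT_comp mF _.
have [N _ far_X] := ae_cvg_in_probability mFG mX F_cvg c40 eta0.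
exists (maxn N (num_vertices S)) => // t /=.
rewrite geq_max => /andP[Nt St] n tn.
have Nn := leq_trans Nt tn; have Sn := leq_trans St tn.
have mfar m b : measurable [set w | b <= `|F (G m w) - X w|].
  exact: measurable_dist_ge.
have far : (P [set w | (c / 2 <= `|F (G t w) - F (G n w)|)%R] <=
    (e / 6)%:E + (e / 6)%:E)%E.
  apply: le_trans (leeD (far_X _ Nt) (far_X _ Nn)).
  apply: le_trans (measureU2 P (mfar _ _) (mfar _ _)).
  apply: le_measure; rewrite ?inE; [exact: measurable_dist_ge| |].
    by apply: measurableU; exact: mfar.
  move=> w /= far; have [|tX] := leP (c / 4) `|F (G t w) - X w|; first by left.
  right; rewrite leNgt; apply/negP => nX; move: far; rewrite leNgt => /negP.
  apply; rewrite (_ : F (G t w) - F (G n w) =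
    (F (G t w) - X w) - (F (G n w) - X w)); last by lra.
  by rewrite (le_lt_trans (ler_normB _ _))//; lra.
have concentration g :
    (P [set w | (`|F (G n w) - F g| < c)%R] <= (e / 6 + e / 6)%:E)%E.
  have mball : measurable (X @^-1` ball (F g) (2 * c)).
    rewrite -[X in measurable X]setTI; apply: mX => //.
    exact: measurable_ball.
  have Xball : (P (X @^-1` ball (F g) (2 * c)%R) <= (e / 6)%:E)%E.
    have ball_le : (lebesgue_measure (ball (F g) (2 * c)) <= r%:E)%E.
      rewrite lebesgue_measure_ball ?lee_fin; last by lra.
      by rewrite mulr2n /c; lra.
    by apply/ltW; apply: X_small ball_le; exact: measurable_ball.
  rewrite EFinD; apply: le_trans (leeD Xball (far_X _ Nn)).
  apply: le_trans (measureU2 P mball (mfar _ _)).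
  apply: le_measure; rewrite ?inE.
  - rewrite (_ : [set _ | _] = ~` [set w | c <= `|F (G n w) - cst (F g) w|]).
      by apply: measurableC; exact: measurable_dist_ge.
    by apply/seteqP; split=> w /=; rewrite ltNge => /negP.
  - by apply: measurableU => //; exact: mfar.
  move=> w /= close.
  have [|nX] := leP (c / 4) `|F (G n w) - X w|; first by right.
  left; rewrite /ball /= (_ : F g - X w =
    (F (G n w) - X w) - (F (G n w) - F g)); last by lra.
  by rewrite (le_lt_trans (ler_normB _ _))//; lra.
have Stn : (num_vertices S <= t <= n)%N by rewrite St.
have CG := le_trans (correlated_far_le G_growth F c Stn) (leeD far far).
have prod := product_close_le G_growth Sn concentration.
have mclose := measurable_ugraph_pair (close_pairs F c).
rewrite (probability_setC (correlated_growth_law K n t S))// in CG.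
apply: le_trans (TV_ge _ _ mclose); apply: le_trans (ler_norm _).
move: CG prod.
rewrite -(fineK (probability_fin_num (correlated_growth_law K n t S) mclose)).
rewrite -(fineK (probability_fin_num (growth_law_pair K n S) mclose)).
rewrite -EFinB -!EFinD !lee_fin /=.
lra.
Qed.

End limit.

(* [f] is defined on the range only; ['valL_0 f] extends it by 0 to all graphs,
   and almost surely every [G t] with [t] >= |S| lies in the range. *)
Theorem theorem1p6 (R : realType) (S : ugraph) (K : attachment_rule R)
    (d : measure_display) (Omega : measurableType d) (P : probability Omega R)
    (G : nat -> {RV P >-> ugraph}) (G_growth : growth_process K S G)
    (f : growth_range K S -> R) (f_infty : {RV P >-> R})
    (f_lim : {ae P, forall w, 'valL_0 f (G t w) @[t --> \oo] --> f_infty w})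
    (f_infty_ac : absolutely_continuous f_infty) :
  (forall tstar : nat, (num_vertices S <= tstar)%N ->
     cvgn (fun n => TV (correlated_growth_law K n tstar S)
                       (growth_law_pair K n S))) /\
  limn (fun n => TV (correlated_growth_law K n tstar S)
                    (growth_law_pair K n S)) @[tstar --> \oo] --> (1 : R).
Proof.
split; first by move=> t St; exact: TV_correlated_cvg.
apply/cvgrPdist_le => e e0.
have := TV_correlated_near1 G_growth f_lim f_infty_ac e0.
move=> [N _ TV_ge1]; exists (maxn N (num_vertices S)) => // t /=.
rewrite geq_max => /andP[Nt St].
have cvgTV := TV_correlated_cvg (K := K) St.
have le1 : limn (fun n => TV (correlated_growth_law K n t S)
    (growth_law_pair K n S)) <= 1.
  by apply: limr_le => //; apply: nearW => n; exact: TV_le1.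
have ge1 : 1 - e <= limn (fun n => TV (correlated_growth_law K n t S)
    (growth_law_pair K n S)).
  by apply: limr_ge => //; exists t => // n /=; exact: TV_ge1.
by rewrite ger0_norm ?subr_ge0//; lra.
Qed.
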